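(* Consider a well-formed document and paths $p_1,p_2,p_3$, each pointing to a mixin written in the document (i.e. the three paths exist), each with its first label defined at the top level of the document. Let \texttt{\_\_merge} be a reserved label: outside the definition displayed below it is written nowhere in the document, neither as a definition key nor inside any reference. Suppose the document's top level contains the definition \begin{verbatim} __merge: - LeftPair: [[p1], [p2]] - RightPair: [[p2], [p3]] - mergedLeft: [[LeftPair], [p3]] - mergedRight: [[p1], [RightPair]] - mergedFlat: [[p1], [p2], [p3]] \end{verbatim} (where $[p_i]$ is the lexical reference listing the labels of $p_i$), with the five wrapper labels distinct from the first labels of $p_1,p_2,p_3$. Then for every finite label sequence $w$, the sets $$\{\,o : (\_,o)\in\mathrm{supers}((\texttt{\_\_merge},X)\frown w),\ o\text{ does not have }(\texttt{\_\_merge})\text{ as a prefix}\,\}$$ are equal for $X=\texttt{mergedLeft}$, $X=\texttt{mergedRight}$ and $X=\texttt{mergedFlat}$. In particular, the three paths $(\texttt{\_\_merge},X)\frown w$ either all exist or all fail to exist, where a path $q$ exists iff $\mathrm{supers}(q)\neq\varnothing$.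
   Context: **Documents.** A node is a scalar (a tag and a string), a sequence (a tag and a finite list of nodes) or a mapping (a tag and a finite list of pairs of nodes). The relevant tags are !!seq, !!map, !!str, !!null. A program (document) is a finite node $\mathrm{doc}$ (a YAML document without anchors). Labels are strings; a path is a finite sequence of labels; $()$ is the root path; $p\triangleright\ell$ appends a label; $p\frown w$ concatenates a label sequence; for $p\ne()$, $\mathrm{init}(p)$ drops the last label and $\mathrm{last}(p)$ is the last label (both undefined at $()$). Set comprehensions silently omit terms in which a partial function is undefined, and are empty if their source is undefined. **Surface form.** A mixin body is a !!seq sequence of members; a member is either a reference (a !!seq sequence of scalars, written $[\ell_1,\dots,\ell_k]$) or a definition (a single-pair !!map mapping $\ell: m$ from a !!str scalar $\ell$ to a mixin body $m$). **Syntactic helpers.** $\mathrm{items}(\mathit{node})$ is the list of children if $\mathit{node}$ is a !!seq sequence (undefined otherwise). $\mathrm{kv}(\mathit{node})=(\ell,m)$ if $\mathit{node}$ is a !!map mapping with exactly one pair, whose key is a !!str scalar with content $\ell$ and whose value is $m$ (undefined otherwise). $\mathrm{at}(())=\mathrm{doc}$; $\mathrm{at}(p\triangleright\ell)$ is the unique $m$ with $(\ell,m)=\mathrm{kv}(\mathit{node})$ for some $\mathit{node}\in\mathrm{items}(\mathrm{at}(p))$. $\mathrm{has}(p,\ell)$ holds iff some $\mathit{node}\in\mathrm{items}(\mathrm{at}(p))$ has $\mathrm{kv}(\mathit{node})=(\ell,\_)$. $\mathrm{lexical}(p,\ell)=0$ if $\mathrm{has}(p,\ell)$, else $1+\mathrm{lexical}(\mathrm{init}(p),\ell)$.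 $\mathrm{qualified}(p,\ell)=0$ if $\mathrm{last}(p)=\ell$, else $1+\mathrm{qualified}(\mathrm{init}(p),\ell)$. For a list of scalars $r=(s_1,\dots,s_k)$: if $s_2$ is !!null, $\mathrm{indexed}(p,r)=(\mathrm{qualified}(\mathrm{init}(p),s_1),(s_3,\dots,s_k))$; otherwise $\mathrm{indexed}(p,r)=(\mathrm{lexical}(\mathrm{init}(p),s_1),(s_1,\dots,s_k))$ (scalars read as labels, requiring !!str). $\mathrm{dom}(\mathrm{inherits})=\{p: p=()\text{ or }\mathrm{has}(\mathrm{init}(p),\mathrm{last}(p))\}$, and for $p$ in it $\mathrm{inherits}(p)=\{\mathrm{indexed}(p,\mathrm{items}(r)) : r\in\mathrm{items}(\mathrm{at}(p))\}\subseteq\mathbb N\times\mathrm{Label}^*$. **Well-formedness** (standing assumption on documents): at every written position, the node is a !!seq sequence; no two members of one mixin are definitions with the same label; every member is a reference (!!seq node) or a definition (single-pair !!map node with !!str key); and for each written reference the $\mathrm{lexical}$ (resp. $\mathrm{qualified}$) climb is defined, i.e. finds a match before going past the root. **Semantics.** The five functions are the least solution (pointwise inclusion; least fixed point of the associated monotone operator) of: - $\mathrm{supers}(())=\{((),())\}$; $\mathrm{supers}(p\triangleright\ell)=\{(\mathrm{init}(b),o): b\in\mathrm{bases}^*(p\triangleright\ell),\ o\in\mathrm{overrides}(b)\}$, with $\mathrm{bases}^*$ the reflexive-transitive closure; - $\mathrm{overrides}(())=\{()\}$; $\mathrm{overrides}(p\triangleright\ell)=\{o : (\_,b)\in\mathrm{supers}(p),\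 b\triangleright\ell\in\mathrm{dom}(\mathrm{inherits}),\ o\in\{p\triangleright\ell,\,b\triangleright\ell\}\}$; - $\mathrm{bases}(())=\varnothing$; $\mathrm{bases}(p\triangleright\ell)=\{t : o\in\mathrm{overrides}(p\triangleright\ell),\ (n,w)\in\mathrm{inherits}(o),\ t\in\mathrm{resolve}(p,o,n,w)\}$; - $\mathrm{resolve}(s,d,n,w)=\{c\frown w : c\in\mathrm{this}(\{s\},\mathrm{init}(d),n)\}$; - $\mathrm{this}(S,d,0)=S$; for $n>0$, $\mathrm{this}(S,d,n)=\bigcup_{c\in S}\bigcup_{(t,d)\in\mathrm{supers}(c)}\mathrm{this}(\{t\},\mathrm{init}(d),n-1)$. The second component $o$ of a pair in $\mathrm{supers}(q)$ is its override component. *)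

(* Defs.v *)
(* Sets are predicates.  A partial function is given by its graph, or returns
   an [option]. *)
From Stdlib Require Export String List.
Export ListNotations.
#[global] Open Scope string_scope.
#[global] Open Scope list_scope.

Definition tag := string.

Inductive node : Type :=
| Scalar (t : tag) (content : string)
| Sequence (t : tag) (children : list node)
| Mapping (t : tag) (pairs : list (node * node)).

Definition tag_seq : tag := "!!seq".
Definition tag_map : tag := "!!map".
Definition tag_str : tag := "!!str".
Definition tag_null : tag := "!!null".

Definition label := string.

(* Labels are listed from the root: [] is the root path, and a path differs
   from the root exactly when it has the form [p ▷ l], in which case its init
   is [p] and its last label is [l]. *)
Definition path := list label.

Notation "p ▷ l" := (p ++ [l]) (at level 55, left associativity).

Definition str (l : label) : node := Scalar tag_str l.

Definition is_scalar (nd : node) : bool :=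
  match nd with Scalar _ _ => true | _ => false end.

Definition is_null (nd : node) : bool :=
  match nd with Scalar t _ => String.eqb t tag_null | _ => false end.

Definition items (nd : node) : option (list node) :=
  match nd with
  | Sequence t ms => if String.eqb t tag_seq then Some ms else None
  | _ => None
  end.

Definition kv (nd : node) : option (label * node) :=
  match nd with
  | Mapping t [(Scalar u l, m)] =>
      if (String.eqb t tag_map && String.eqb u tag_str)%bool
      then Some (l, m) else None
  | _ => None
  end.

Inductive node_at (doc : node) : path -> node -> Prop :=
| node_at_root : node_at doc [] doc
| node_at_snoc p l nd ms m :
    node_at doc p nd -> items nd = Some ms ->
    unique (fun m => exists nd', In nd' ms /\ kv nd' = Some (l, m)) m ->
    node_at doc (p ▷ l) m.

(* [m] is an element of items(at(p)). *)
Definition member (doc : node) (p : path) (m : node) : Prop :=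
  exists nd ms, node_at doc p nd /\ items nd = Some ms /\ In m ms.

Definition has (doc : node) (p : path) (l : label) : Prop :=
  exists nd m, member doc p nd /\ kv nd = Some (l, m).

(* Graphs of the two climbs; neither has a value when the climb goes past the
   root without finding a match. *)
Inductive lexical (doc : node) : path -> label -> nat -> Prop :=
| lexical_here p l : has doc p l -> lexical doc p l 0
| lexical_up p k l n :
    ~ has doc (p ▷ k) l -> lexical doc p l n -> lexical doc (p ▷ k) l (S n).

Inductive qualified : path -> label -> nat -> Prop :=
| qualified_here p l : qualified (p ▷ l) l 0
| qualified_up p k l n :
    k <> l -> qualified p l n -> qualified (p ▷ k) l (S n).

(* [climb doc p r n u]: the climb for the reference with scalars [r] written
   at [p] has value [n], and [u] are the scalars to be followed after it.  It
   starts at init(p), so it is undefined for a reference written at the root. *)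
Inductive climb (doc : node) : path -> list node -> nat -> list node -> Prop :=
| climb_qualified q k l s r n :
    is_null s = true -> qualified q l n ->
    climb doc (q ▷ k) (str l :: s :: r) n r
| climb_lexical q k l r n :
    (forall s r', r = s :: r' -> is_null s = false) -> lexical doc q l n ->
    climb doc (q ▷ k) (str l :: r) n (str l :: r).

Definition indexed (doc : node) (p : path) (r : list node) (n : nat) (w : path)
  : Prop := climb doc p r n (map str w).

Definition dom_inherits (doc : node) (p : path) : Prop :=
  p = [] \/ exists q l, p = q ▷ l /\ has doc q l.

Definition inherits (doc : node) (p : path) (n : nat) (w : path) : Prop :=
  dom_inherits doc p /\
  exists m r, member doc p m /\ items m = Some r /\ indexed doc p r n w.

Definition keys (ms : list node) : list label :=
  flat_map (fun m => match kv m with Some (l, _) => [l] | None => [] end) ms.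

Record well_formed (doc : node) : Prop := {
  wf_seq : forall p nd, node_at doc p nd -> exists ms, items nd = Some ms;
  wf_distinct : forall p nd ms,
    node_at doc p nd -> items nd = Some ms -> NoDup (keys ms);
  wf_member : forall p m, member doc p m ->
    (exists r, items m = Some r /\ Forall (fun s => is_scalar s = true) r) \/
    (exists l b, kv m = Some (l, b));
  wf_climb : forall p m r, member doc p m -> items m = Some r ->
    exists n u, climb doc p r n u
}.

(* The least solution of the five equations: each clause of this mutual
   definition is one of their closure rules.  [supers doc p t o] means that
   (t, o) is in supers(p), and for a set S of paths, [this doc S d n] is the
   set this(S, d, n); the singleton {s} is [eq s].  [bases_star] is the
   reflexive-transitive closure of [bases]. *)
Inductive supers (doc : node) : path -> path -> path -> Prop :=
| supers_root : supers doc [] [] []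
| supers_snoc p l b k o :
    bases_star doc (p ▷ l) (b ▷ k) -> overrides doc (b ▷ k) o ->
    supers doc (p ▷ l) b o
with overrides (doc : node) : path -> path -> Prop :=
| overrides_root : overrides doc [] []
| overrides_self p l t b :
    supers doc p t b -> dom_inherits doc (b ▷ l) ->
    overrides doc (p ▷ l) (p ▷ l)
| overrides_super p l t b :
    supers doc p t b -> dom_inherits doc (b ▷ l) ->
    overrides doc (p ▷ l) (b ▷ l)
with bases (doc : node) : path -> path -> Prop :=
| bases_snoc p l o n w t :
    overrides doc (p ▷ l) o -> inherits doc o n w -> resolve doc p o n w t ->
    bases doc (p ▷ l) t
with bases_star (doc : node) : path -> path -> Prop :=
| bases_star_refl p : bases_star doc p p
| bases_star_step p q r :
    bases doc p q -> bases_star doc q r -> bases_star doc p r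
with resolve (doc : node) : path -> path -> nat -> path -> path -> Prop :=
| resolve_intro s d k n w c :
    this doc (eq s) d n c -> resolve doc s (d ▷ k) n w (c ++ w)
with this (doc : node) : (path -> Prop) -> path -> nat -> path -> Prop :=
| this_zero (S : path -> Prop) d c : S c -> this doc S d 0 c
| this_succ (S : path -> Prop) d k n c t x :
    S c -> supers doc c t (d ▷ k) -> this doc (eq t) d n x ->
    this doc S (d ▷ k) (Datatypes.S n) x.

Definition path_exists (doc : node) (p : path) : Prop :=
  exists t o, supers doc p t o.

Definition first_label_at_top (doc : node) (p : path) : Prop :=
  exists l, hd_error p = Some l /\ has doc [] l.

Definition definition (l : label) (body : node) : node :=
  Mapping tag_map [(str l, body)].

(* The mixin body whose members are the references in [rs]. *)
Definition refs (rs : list path) : node :=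
  Sequence tag_seq (map (fun r => Sequence tag_seq (map str r)) rs).

Definition merge_label : label := "__merge".

Definition left_pair : label := "LeftPair".
Definition right_pair : label := "RightPair".
Definition merged_left : label := "mergedLeft".
Definition merged_right : label := "mergedRight".
Definition merged_flat : label := "mergedFlat".

Definition wrapper_labels : list label :=
  [left_pair; right_pair; merged_left; merged_right; merged_flat].

Definition merge_definition (p1 p2 p3 : path) : node :=
  definition merge_label
    (Sequence tag_seq
       [ definition left_pair    (refs [p1; p2]);
         definition right_pair   (refs [p2; p3]);
         definition merged_left  (refs [[left_pair]; p3]);
         definition merged_right (refs [p1; [right_pair]]);
         definition merged_flat  (refs [p1; p2; p3]) ]).

(* [m] is a definition with key [l], or a reference listing [l]. *)
Definition mentions (l : label) (m : node) : Prop :=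
  (exists b, kv m = Some (l, b)) \/
  (exists r, items m = Some r /\ In (str l) r).

Definition has_prefix (l : label) (p : path) : Prop := hd_error p = Some l.

(* The members written inside the top-level definition of [l] are those at the
   paths starting with [l]. *)
Definition reserved (doc : node) (l : label) (displayed : node) : Prop :=
  forall p m, member doc p m ->
    ~ (p = [] /\ m = displayed) -> ~ has_prefix l p -> ~ mentions l m.

(* The override components of supers((__merge, X) ++ w) that do not have
   (__merge) as a prefix. *)
Definition outer_overrides (doc : node) (X : label) (w : path) (o : path)
  : Prop :=
  (exists t, supers doc ([merge_label; X] ++ w) t o) /\
  ~ has_prefix merge_label o.

(* Main.v *)
(* Two merged mixins X and Y reach exactly the paths p1, p2, p3 and their bases,
   apart from the wrappers themselves.  A derivation of a fact about
   (__merge, X) ++ v is translated, by induction on it, into one about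
   (__merge, Y) ++ v.  The translation can fail only for override components of
   the form (__merge, l, ...): those are the paths themselves and the pairs
   LeftPair and RightPair, which X and Y need not share.  But no definition is
   written at a path (__merge, l, ...), so such a component neither gives rise
   to an override of a child nor occurs as the argument d of [this] in the
   resolution of a reference, and nothing else depends on it. *)
Require Import Defs.
From Stdlib Require Import Classical.

(** * Written nodes, members and keys *)

Lemma node_at_snoc_inv doc p l m :
  node_at doc (p ▷ l) m ->
  exists nd ms, node_at doc p nd /\ items nd = Some ms /\
    unique (fun m => exists nd', In nd' ms /\ kv nd' = Some (l, m)) m.
Proof.
  inversion 1 as [e | q k nd ms b Hq Hi Hu e].
  - now destruct p.
  - apply app_inj_tail in e as [-> ->]. now exists nd, ms.
Qed.

Lemma node_at_fun doc p m m' : node_at doc p m -> node_at doc p m' -> m = m'.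
Proof.
  intros H; revert m'.
  induction H as [| p l nd ms m Hp IH Hi Hu]; intros m' H'.
  - inversion H' as [| q]; [reflexivity | now destruct q].
  - destruct (node_at_snoc_inv _ _ _ _ H') as (nd' & ms' & Hp' & Hi' & Hu').
    rewrite <- (IH _ Hp'), Hi in Hi'. injection Hi' as <-.
    apply Hu, Hu'.
Qed.

Lemma node_at_snoc_has doc p l m : node_at doc (p ▷ l) m -> has doc p l.
Proof.
  intros (nd & ms & Hp & Hi & (nd' & Hin & Hkv) & _)%node_at_snoc_inv.
  exists nd', m. split; [exists nd, ms|]; auto.
Qed.

Lemma member_inv doc p nd ms m :
  node_at doc p nd -> items nd = Some ms -> member doc p m -> In m ms.
Proof.
  intros Hp Hi (nd' & ms' & Hp' & Hi' & Hin).
  rewrite (node_at_fun _ _ _ _ Hp' Hp), Hi in Hi'. now injection Hi' as ->.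
Qed.

Lemma in_keys ms m l b : In m ms -> kv m = Some (l, b) -> In l (keys ms).
Proof.
  intros Hin Hkv. apply in_flat_map. exists m. rewrite Hkv. now split; [|left].
Qed.

Lemma keys_inj ms m m' l b b' :
  NoDup (keys ms) -> In m ms -> In m' ms ->
  kv m = Some (l, b) -> kv m' = Some (l, b') -> b = b'.
Proof.
  induction ms as [| a ms IH]; [easy|].
  change (keys (a :: ms)) with
    ((match kv a with Some (l, _) => [l] | None => [] end) ++ keys ms).
  intros Hnd Hm Hm' Hk Hk'.
  assert (NoDup (keys ms)) as Hnd' by (destruct (kv a) as [[]|]; [now inversion Hnd | easy]).
  destruct Hm as [-> | Hm], Hm' as [-> | Hm']; [congruence | | | eauto].
  - rewrite Hk in Hnd. inversion Hnd as [| ? ? Hn]. elim Hn. eapply in_keys; eauto.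
  - rewrite Hk' in Hnd. inversion Hnd as [| ? ? Hn]. elim Hn. eapply in_keys; eauto.
Qed.

Lemma node_at_member doc p m l b :
  well_formed doc -> member doc p m -> kv m = Some (l, b) -> node_at doc (p ▷ l) b.
Proof.
  intros Hwf (nd & ms & Hp & Hi & Hin) Hkv.
  apply node_at_snoc with nd ms; trivial. split; [eauto|].
  intros b' (m' & Hin' & Hkv').
  exact (keys_inj ms m m' l b b' (wf_distinct _ Hwf _ _ _ Hp Hi) Hin Hin' Hkv Hkv').
Qed.

Lemma dom_inherits_snoc doc p l : dom_inherits doc (p ▷ l) <-> has doc p l.
Proof.
  split.
  - intros [e | (q & k & e & H)]; [now destruct p|].
    now apply app_inj_tail in e as [-> ->].
  - right; eauto.
Qed.

(** * Inversion of the semantic equations *)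

Lemma supers_root_inv doc t o : supers doc [] t o -> t = [] /\ o = [].
Proof. inversion 1 as [| p]; [easy | now destruct p]. Qed.

Lemma supers_snoc_inv doc p l t o :
  supers doc (p ▷ l) t o ->
  exists k, bases_star doc (p ▷ l) (t ▷ k) /\ overrides doc (t ▷ k) o.
Proof.
  inversion 1 as [e | q k b k' o' Hb Ho e]; [now destruct p | subst].
  apply app_inj_tail in e as [-> ->]. eauto.
Qed.

Lemma overrides_snoc_inv doc p l o :
  overrides doc (p ▷ l) o ->
  exists t b, supers doc p t b /\ has doc b l /\ (o = p ▷ l \/ o = b ▷ l).
Proof.
  inversion 1 as [e | q k t b Hs Hd e | q k t b Hs Hd e]; [now destruct p | |];
    apply app_inj_tail in e as [-> ->]; apply dom_inherits_snoc in Hd; eauto 6.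
Qed.

(** The root is its own only super, so the path's own override and the inherited one coincide. *)
Lemma overrides_top doc l o : overrides doc [l] o -> o = [l].
Proof.
  intros (t & b & Hs & _ & H)%(overrides_snoc_inv doc []).
  apply supers_root_inv in Hs as [_ ->]. now destruct H.
Qed.

Lemma bases_snoc_inv doc p l x :
  bases doc (p ▷ l) x ->
  exists o n w, overrides doc (p ▷ l) o /\ inherits doc o n w /\ resolve doc p o n w x.
Proof.
  inversion 1 as [q k o n w t Ho Hi Hr e]. apply app_inj_tail in e as [-> ->]. eauto 6.
Qed.

Lemma bases_star_head doc p r :
  bases_star doc p r -> p = r \/ exists q, bases doc p q.
Proof. destruct 1; eauto. Qed.

(** Any chain of bases needs an override at its start: a trivial chain has the override of its end,
    and a first step arises from one. Conversely, an override shows [p ▷ l] to be an override of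
    itself, reached by the trivial chain. *)
Lemma supers_exists_iff doc p l :
  path_exists doc (p ▷ l) <-> exists t b, supers doc p t b /\ has doc b l.
Proof.
  split.
  - intros (t & o & (k & Hb & Ho)%supers_snoc_inv).
    assert (exists x, overrides doc (p ▷ l) x) as [x H'].
    { apply bases_star_head in Hb as [e | (q & Hq)].
      - rewrite <- e in Ho. eauto.
      - apply bases_snoc_inv in Hq as (? & ? & ? & ? & _). eauto. }
    apply overrides_snoc_inv in H' as (? & ? & ? & ? & _). eauto.
  - intros (t & b & Hs & Hh). exists p, (p ▷ l). apply supers_snoc with l.
    + apply bases_star_refl.
    + eapply overrides_self; [eauto | now apply dom_inherits_snoc].
Qed.

Lemma this_zero_inv doc S d x : this doc S d 0 x -> S x.
Proof. now inversion 1. Qed.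

Lemma this_succ_inv doc (S : path -> Prop) d k n x :
  this doc S (d ▷ k) (Datatypes.S n) x ->
  exists c t, S c /\ supers doc c t (d ▷ k) /\ this doc (eq t) d n x.
Proof.
  inversion 1 as [| S' d' k' n' c t x' HS Hs Ht e1 e2]; subst.
  match goal with e : _ ▷ _ = _ ▷ _ |- _ => apply app_inj_tail in e as [-> ->] end.
  eauto.
Qed.

Lemma bases_star_trans doc p q r :
  bases_star doc p q -> bases_star doc q r -> bases_star doc p r.
Proof. induction 1; eauto using bases_star. Qed.

(** A list of [!!str] scalars has no [!!null] in second place, so its climb is the lexical one; the
    labels are recovered because [map str] is injective. *)
Lemma indexed_labels doc q k r n w :
  indexed doc (q ▷ k) (map str r) n w <->
  w = r /\ exists l r', r = l :: r' /\ lexical doc q l n.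
Proof.
  unfold indexed. split.
  - remember (q ▷ k) as p eqn:Ep. remember (map str r) as s eqn:Es.
    remember (map str w) as u eqn:Eu.
    destruct 1 as [q' k' l s r' n Hn | q' k' l r' n Hn Hl];
      apply app_inj_tail in Ep as [-> ->].
    + destruct r as [| a [| b r]]; try discriminate. injection Es as -> -> ->. discriminate.
    + rewrite Es in Eu. assert (r = w) as <-.
      { clear -Eu. revert w Eu. induction r as [| a r IH]; intros [| b w]; try discriminate;
          [easy|]. cbn. intros [= -> E]. f_equal; auto. }
      split; [easy|]. destruct r as [| a r]; [discriminate|]. injection Es as -> ->. eauto.
  - intros (-> & l & r' & -> & H). apply climb_lexical; [|easy].
    intros s u. destruct r'; [easy|]. now intros [= <- _].
Qed.

(** * Wrapper paths and their counterparts *)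

Definition merge_path (l : label) : path := [merge_label; l].

Definition inside_wrapper (p : path) : Prop := exists l v, p = merge_path l ++ v.

(** Deliberately not a function: a path below [merge_path X] is related both to itself and to its
    counterpart below [merge_path Y]. *)
Definition twin (X Y : label) (q q' : path) : Prop :=
  q = q' \/ exists v, q = merge_path X ++ v /\ q' = merge_path Y ++ v.

Lemma twin_app X Y q q' w : twin X Y q q' -> twin X Y (q ++ w) (q' ++ w).
Proof.
  intros [-> | (v & -> & ->)]; [now left | right].
  exists (v ++ w). now rewrite !app_assoc.
Qed.

Lemma inside_wrapper_snoc p l : inside_wrapper p -> inside_wrapper (p ▷ l).
Proof. intros (k & v & ->). exists k, (v ▷ l). now rewrite app_assoc. Qed.

(** The displayed definition as a table, so that the five wrappers can be treated uniformly. *)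
Definition wrapper_refs (p1 p2 p3 : path) : list (label * list path) :=
  [ (left_pair, [p1; p2]); (right_pair, [p2; p3]);
    (merged_left, [[left_pair]; p3]); (merged_right, [p1; [right_pair]]);
    (merged_flat, [p1; p2; p3]) ].

Definition merged_labels : list label := [merged_left; merged_right; merged_flat].

Scheme supers_mut := Minimality for supers Sort Prop
  with overrides_mut := Minimality for overrides Sort Prop
  with bases_mut := Minimality for bases Sort Prop
  with bases_star_mut := Minimality for bases_star Sort Prop
  with resolve_mut := Minimality for resolve Sort Prop
  with this_mut := Minimality for this Sort Prop.

Section Merge.

Context (doc : node) (p1 p2 p3 : path).
Context (Hwf : well_formed doc).
Context (Htop : forall p, In p [p1; p2; p3] -> first_label_at_top doc p).
Context (Hmerge : member doc [] (merge_definition p1 p2 p3)).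
Context (Hwrappers : forall p l, In p [p1; p2; p3] -> hd_error p = Some l ->
  ~ In l wrapper_labels).

Let wrappers := wrapper_refs p1 p2 p3.

(** * What is written inside [__merge] *)

Lemma member_merge m :
  member doc [merge_label] m <->
  exists l rs, In (l, rs) wrappers /\ m = definition l (refs rs).
Proof.
  (* The displayed body is convertible to this image of the table. *)
  assert (node_at doc [merge_label]
    (Sequence tag_seq (map (fun '(l, rs) => definition l (refs rs)) wrappers))) as H.
  { change [merge_label] with ([] ▷ merge_label).
    now apply node_at_member with (1 := Hwf) (2 := Hmerge). }
  split.
  - intros Hm. eapply member_inv in Hm; [| exact H | reflexivity].
    apply in_map_iff in Hm as ([l rs] & <- & Hin). eauto.
  - intros (l & rs & Hin & ->). eexists _, _. split; [exact H|]. split; [reflexivity|].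
    apply in_map_iff. now exists (l, rs).
Qed.

Lemma has_merge l : has doc [merge_label] l <-> In l wrapper_labels.
Proof.
  change wrapper_labels with (map fst wrappers). rewrite in_map_iff. split.
  - intros (nd & m & Hm & Hkv). apply member_merge in Hm as (k & rs & Hin & ->).
    injection Hkv as -> _. now exists (l, rs).
  - intros ([k rs] & e & Hin). cbn in e. subst k. exists (definition l (refs rs)), (refs rs).
    split; [apply member_merge; eauto | reflexivity].
Qed.

Lemma node_at_wrapper l rs : In (l, rs) wrappers -> node_at doc (merge_path l) (refs rs).
Proof.
  intros Hin. change (merge_path l) with ([merge_label] ▷ l).
  eapply node_at_member; [exact Hwf | apply member_merge; eauto | reflexivity].
Qed.

Lemma member_wrapper l rs m :
  In (l, rs) wrappers ->
  member doc (merge_path l) m <->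
  exists r, In r rs /\ m = Sequence tag_seq (map str r).
Proof.
  intros Hl%node_at_wrapper. split.
  - intros Hm. eapply member_inv in Hm; [| exact Hl | reflexivity].
    apply in_map_iff in Hm as (r & <- & Hin). eauto.
  - intros (r & Hin & ->). eexists _, _. split; [exact Hl|]. split; [reflexivity|].
    apply in_map_iff. eauto.
Qed.

(** Wrapper bodies hold only references, and a node further down would need a definition in its
    parent, which the induction on depth excludes. *)
Lemma has_not_inside p l : has doc p l -> ~ inside_wrapper p.
Proof.
  intros H (k & v & ->). revert l H.
  induction v as [| a v IH] using rev_ind; intros l H.
  - rewrite app_nil_r in H. destruct H as (nd & m & Hm & Hkv).
    assert (has doc [merge_label] k) as Hk.
    { destruct Hm as (nd' & ? & Hnd & _). now apply (node_at_snoc_has doc [merge_label] k nd'). }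
    apply has_merge in Hk. change wrapper_labels with (map fst wrappers) in Hk.
    apply in_map_iff in Hk as ([k' rs] & e & Hin). cbn in e. subst k'.
    apply (member_wrapper _ _ _ Hin) in Hm as (r & _ & ->). discriminate.
  - destruct H as (nd & m & (nd' & ms & Hnd & _) & _).
    rewrite app_assoc in Hnd. apply node_at_snoc_has in Hnd. eauto.
Qed.

(** * Supers, overrides and bases of the wrappers *)

Lemma supers_merge t o :
  supers doc [merge_label] t o -> t = [] /\ o = [merge_label].
Proof.
  intros (k & Hb & Ho)%(supers_snoc_inv doc []).
  assert (t ▷ k = [] ▷ merge_label) as E.
  (* A first step would need a reference among the members of [__merge], which are all definitions;
     so the chain of bases is trivial. *)
  { apply bases_star_head in Hb as [<- | (q & Hq)]; [easy|].
    apply (bases_snoc_inv doc []) in Hq as (o' & n & w & Ho' & (_ & m & r' & Hm & Hi & _) & _).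
    apply overrides_top in Ho' as ->.
    apply member_merge in Hm as (? & ? & _ & ->). discriminate. }
  rewrite E in Ho. apply app_inj_tail in E as [-> ->].
  now apply overrides_top in Ho as ->.
Qed.

Lemma supers_merge_self : supers doc [merge_label] [] [merge_label].
Proof.
  apply supers_snoc with (p := []) (k := merge_label); [apply bases_star_refl|].
  apply overrides_self with (p := []) (t := []) (b := []); [constructor|].
  apply dom_inherits_snoc. now exists (merge_definition p1 p2 p3); eexists.
Qed.

Lemma overrides_wrapper l o : overrides doc (merge_path l) o -> o = merge_path l.
Proof.
  intros (t & b & Hs & _ & H)%(overrides_snoc_inv doc [merge_label]).
  apply supers_merge in Hs as [_ ->]. now destruct H.
Qed.

(** Treats both kinds of reference at once: [n] is 0 for a sibling wrapper, with scope [c] equal to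
    [[merge_label]], and 1 for a top-level path, with scope the root. *)
Lemma bases_wrapper l rs r n c :
  In (l, rs) wrappers -> In r rs -> hd_error r <> None ->
  (forall k, hd_error r = Some k -> lexical doc [merge_label] k n) ->
  this doc (eq [merge_label]) [merge_label] n c ->
  bases doc (merge_path l) (c ++ r).
Proof.
  intros Hl Hr Hn Hlex Hc.
  assert (has doc [merge_label] l) as Hh.
  { apply has_merge. change wrapper_labels with (map fst wrappers).
    apply in_map_iff. now exists (l, rs). }
  destruct r as [| k r]; [easy|]. clear Hn.
  apply bases_snoc with (p := [merge_label]) (o := merge_path l) (n := n) (w := k :: r).
  - apply overrides_self with (p := [merge_label]) (t := []) (b := [merge_label]);
      [apply supers_merge_self | now apply dom_inherits_snoc].
  - split; [now apply (dom_inherits_snoc doc [merge_label])|].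
    exists (Sequence tag_seq (map str (k :: r))), (map str (k :: r)). split; [|split].
    + apply (member_wrapper _ _ _ Hl). eauto.
    + reflexivity.
    + apply (indexed_labels doc [merge_label]). split; [easy|]. exists k, r. auto.
  - now apply (resolve_intro doc [merge_label] [merge_label]).
Qed.

Lemma bases_wrapper_local l rs k :
  In (l, rs) wrappers -> In [k] rs -> In k wrapper_labels ->
  bases doc (merge_path l) (merge_path k).
Proof.
  intros Hl Hk Hw. apply bases_wrapper with (n := 0) (c := [merge_label]) (1 := Hl) (2 := Hk).
  - easy.
  - intros ? [= <-]. constructor. now apply has_merge.
  - now constructor.
Qed.

(** By [Hwrappers] the first label of [p] is not defined in [__merge], so the climb goes one level
    up and finds it at the top. *)
Lemma bases_wrapper_top l rs p :
  In (l, rs) wrappers -> In p rs -> In p [p1; p2; p3] ->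
  bases doc (merge_path l) p.
Proof.
  intros Hl Hp Hp'. destruct (Htop p Hp') as (k & Hk & Hh).
  apply bases_wrapper with (n := 1) (c := []) (1 := Hl) (2 := Hp).
  - now rewrite Hk.
  - intros k' e. replace k' with k by congruence.
    apply (lexical_up doc []); [| now constructor].
    rewrite has_merge. eauto.
  - apply this_succ with (d := []) (k := merge_label) (c := [merge_label]) (t := []);
      [easy | apply supers_merge_self | now constructor].
Qed.

Lemma bases_wrapper_inv l rs x :
  In (l, rs) wrappers -> bases doc (merge_path l) x ->
  exists k r, In (k :: r) rs /\
    (In k wrapper_labels /\ x = merge_path k ++ r \/
     ~ In k wrapper_labels /\ x = k :: r).
Proof.
  intros Hl (o & n & w & Ho & (_ & m & r & Hm & Hi & Hx) & Hr)%(bases_snoc_inv doc [merge_label]).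
  apply overrides_wrapper in Ho as ->.
  apply (member_wrapper _ _ _ Hl) in Hm as (r' & Hin & ->). injection Hi as <-.
  apply (indexed_labels doc [merge_label]) in Hx as (-> & k & u & -> & Hlex).
  exists k, u. split; [easy|].
  inversion Hr as [s d k' n' w' c Hc e1 e2].
  apply (app_inj_tail d [merge_label]) in e2 as [-> ->]. subst.
  inversion Hlex as [q k' Hh | q k' l' n' Hh Hlex' e]; subst.
  - left. split; [now apply has_merge|]. now apply this_zero_inv in Hc as <-.
  - right. apply (app_inj_tail q []) in e as [-> ->].
    split; [now rewrite <- has_merge|].
    (* The climb is already at the root and cannot continue, so it has exactly one step. *)
    inversion Hlex' as [| q ? ? ? ? ? e]; [subst | now destruct q].
    apply (this_succ_inv doc _ []) in Hc as (c' & t & <- & Hs & Ht).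
    apply supers_merge in Hs as [-> _]. now apply this_zero_inv in Ht as <-.
Qed.

(** Each merged mixin refers to [p] directly or through its pair, so at most two steps are
    needed. *)
Lemma bases_star_wrapper X p :
  In X merged_labels -> In p [p1; p2; p3] -> bases_star doc (merge_path X) p.
Proof.
  assert (forall l rs p, In (l, rs) wrappers -> In p rs -> In p [p1; p2; p3] ->
    bases_star doc (merge_path l) p) as Hdirect
    by eauto using bases_star, bases_wrapper_top.
  assert (forall l rs k p, In (l, rs) wrappers -> In [k] rs -> In k wrapper_labels ->
    bases_star doc (merge_path k) p -> bases_star doc (merge_path l) p) as Hpair
    by eauto using bases_star, bases_wrapper_local.
  intros HX Hp.
  destruct HX as [<- | [<- | [<- | []]]].
  - destruct Hp as [<- | [<- | [<- | []]]].
    1,2: apply (Hpair merged_left [[left_pair]; p3] left_pair);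
         try apply (Hdirect left_pair [p1; p2]); cbn; auto.
    apply (Hdirect merged_left [[left_pair]; p3]); cbn; auto.
  - destruct Hp as [<- | Hp].
    + apply (Hdirect merged_right [p1; [right_pair]]); cbn; auto 6.
    + apply (Hpair merged_right [p1; [right_pair]] right_pair);
        try apply (Hdirect right_pair [p2; p3]); cbn; cbn in Hp; tauto.
  - apply (Hdirect merged_flat [p1; p2; p3]); cbn; auto 7.
Qed.

Lemma bases_wrapper_cases l x :
  In l wrapper_labels -> bases doc (merge_path l) x ->
  In x [p1; p2; p3] \/
  (l = merged_left /\ x = merge_path left_pair) \/
  (l = merged_right /\ x = merge_path right_pair).
Proof.
  change wrapper_labels with (map fst wrappers).
  intros ([l' rs] & e & Hl)%in_map_iff Hx. cbn in e. subst l'.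
  destruct (bases_wrapper_inv _ _ _ Hl Hx) as (k & r & Hin & Hk).
  (* [Hwrappers] prevents a reference to a given path from resolving inside [__merge]. *)
  assert (In (k :: r) [p1; p2; p3] -> In x [p1; p2; p3]) as Hp.
  { intros Hr. destruct Hk as [[Hk _] | [_ ->]]; [|easy].
    now elim (Hwrappers _ k Hr eq_refl). }
  cbn in Hl. destruct Hl as [[= <- <-] | [[= <- <-] | [[= <- <-] | [[= <- <-] | [[= <- <-] | []]]]]];
    cbn in Hin.
  (* The two pairs and [merged_flat] refer only to the given paths. *)
  1,2,5: left; apply Hp; cbn; tauto.
  - destruct Hin as [[= <- <-] | Hin]; [| left; apply Hp; cbn; tauto].
    destruct Hk as [[_ ->] | [Hk _]]; [auto | elim Hk; cbn; auto].
  - destruct Hin as [Hin | [[= <- <-] | []]]; [left; apply Hp; cbn; tauto |].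
    destruct Hk as [[_ ->] | [Hk _]]; [auto | elim Hk; cbn; auto].
Qed.

Lemma bases_star_wrapper_inv X r :
  In X wrapper_labels -> bases_star doc (merge_path X) r ->
  (exists l, r = merge_path l) \/
  exists p, In p [p1; p2; p3] /\ bases_star doc p r.
Proof.
  intros HX Hr. remember (merge_path X) as q eqn:Eq. revert X HX Eq.
  induction Hr as [q | q x r Hq Hr IH]; intros X HX ->; [eauto|].
  apply bases_wrapper_cases in Hq as [Hx | [[_ ->] | [_ ->]]]; [eauto | ..];
    [ | | easy]; eapply IH; [| reflexivity | | reflexivity]; cbn; auto.
Qed.

(** * Transfer from one merged mixin to another *)

Section Transfer.

Context (X Y : label) (HX : In X merged_labels) (HY : In Y merged_labels).

Local Notation twin := (twin X Y).

(** A chain that does not end at a wrapper leaves the wrappers through a given path, which [Y]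
    reaches as well; [r] then serves as its own twin. *)
Lemma bases_star_merged_twin r :
  bases_star doc (merge_path X) r ->
  (exists l, r = merge_path l) \/ exists r', bases_star doc (merge_path Y) r' /\ twin r r'.
Proof.
  intros [Hl | (p & Hp & Hr)]%bases_star_wrapper_inv.
  - now left.
  - right. exists r. split; [|now left].
    eapply bases_star_trans; [exact (bases_star_wrapper Y p HY Hp) | easy].
  - cbn in *. tauto.
Qed.

Lemma supers_twin q t o :
  supers doc q t o ->
  forall q', twin q q' -> ~ inside_wrapper o -> exists t', supers doc q' t' o /\ twin t t'.
Proof.
  revert q t o.
  refine (supers_mut doc
    (fun q t o => forall q', twin q q' -> ~ inside_wrapper o ->
       exists t', supers doc q' t' o /\ twin t t')
    (* The override of [q] by itself is exempt, since it need not be an override of the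
       counterpart. *)
    (fun q o => forall q', twin q q' -> overrides doc q' o \/ o = q)
    (* At the merged mixin itself a step may lead to a pair that has no
       counterpart, so only whole chains of bases are translated there. *)
    (fun q x => forall q', twin q q' ->
       q = merge_path X \/ exists x', bases doc q' x' /\ twin x x')
    (* A chain ending at a wrapper is harmless: the only possible override there is the wrapper
       itself, which the case of [supers] excludes. *)
    (fun q r => forall q', twin q q' ->
       (exists l, r = merge_path l) \/ exists r', bases_star doc q' r' /\ twin r r')
    (fun s d n w x => forall d0 k s', d = d0 ▷ k -> ~ inside_wrapper d0 ->
       twin s s' -> exists x', resolve doc s' d n w x' /\ twin x x')
    (* A derivation starts from a single element of [S], so that element is translated rather than
       the set. *)
    (fun S d n x => ~ inside_wrapper d -> exists c, S c /\
       forall c', twin c c' -> exists x', this doc (eq c') d n x' /\ twin x x')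
    _ _ _ _ _ _ _ _ _ _ _).
  - intros q' [<- | (v & [=] & _)] _. exists []. split; [constructor | now left].
  - intros p l b k o Hb IHb Ho IHo q' Hq Hin.
    assert (exists t' k', bases_star doc q' (t' ▷ k') /\ overrides doc (t' ▷ k') o /\ twin b t')
      as (t' & k' & Hb' & Ho' & Htw).
    { destruct (IHb _ Hq) as [[z e] | (r & Hr & Htw)].
      { rewrite e in Ho. apply overrides_wrapper in Ho as ->.
        elim Hin. now exists z, []. }
      destruct Htw as [<- | (v & e & ->)]; [exists b, k; repeat split; auto; now left|].
      destruct v as [| k' v _] using rev_ind.
      { rewrite e, app_nil_r in Ho. apply overrides_wrapper in Ho as ->.
        elim Hin. now exists X, []. }
      (* The override survives unless it is the end of the chain itself, which lies inside a
         wrapper, contrary to [Hin]. *)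
      destruct (IHo (merge_path Y ++ (v ▷ k'))) as [Ho' | ->].
      + right; eauto.
      + rewrite app_assoc in e, Hr, Ho'. apply app_inj_tail in e as [-> ->].
        exists (merge_path Y ++ v), k'. repeat split; auto. right; eauto.
      + elim Hin. rewrite e. now exists X, (v ▷ k'). }
    exists t'. split; [|easy].
    (* [supers_snoc] needs the last label of [q'], which is [Y] when nothing follows the merged
       mixin. *)
    destruct Hq as [<- | (v & e & ->)].
    + eapply supers_snoc; eauto.
    + destruct v as [| l' v _] using rev_ind.
      * rewrite app_nil_r in *. now apply (supers_snoc doc [merge_label] Y _ k').
      * rewrite app_assoc in *. eapply supers_snoc; eauto.
  - intros q' [<- | (v & [=] & _)]. left. constructor.
  - now right.
  - intros p l t b Hs IH Hd q' [<- | (v & e & ->)].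
    { left. eapply overrides_super; eauto. }
    destruct v as [| l' v _] using rev_ind.
    (* At the merged mixin the parent is [__merge], whose only override component is itself, so [o]
       is the path itself. *)
    + right. rewrite app_nil_r in e. apply (app_inj_tail p [merge_label]) in e as [-> ->].
      now apply supers_merge in Hs as [_ ->].
    + left. rewrite app_assoc in *. apply app_inj_tail in e as [-> ->].
      destruct (IH (merge_path Y ++ v)) as (t' & Hs' & _).
      * right; eauto.
      * eapply has_not_inside, dom_inherits_snoc, Hd.
      * eapply overrides_super; eauto.
  - intros p l o n w t Ho IHo [Hd Hi] Hr IHr q' [<- | (v & e & ->)].
    { right. exists t. split; [|now left]. eapply bases_snoc; eauto. now split. }
    destruct v as [| l' v _] using rev_ind; [left; now rewrite app_nil_r in e|].
    right. pose proof (IHo (merge_path Y ++ (v ▷ l'))) as Ho'.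
    rewrite app_assoc in *. apply app_inj_tail in e as [-> ->].
    inversion Hr as [s d k n' w' c Hc e1 e2]; subst.
    (* A path that inherits has its last label defined in its parent. This admits [d] as the
       argument of the climb and, below, rules out that the override is the path itself. *)
    assert (~ inside_wrapper d) as Hnd by (eapply has_not_inside, dom_inherits_snoc, Hd).
    destruct (IHr d k (merge_path Y ++ v)) as (x' & Hr' & Htw); [easy | easy | right; eauto |].
    exists x'. split; [|easy].
    destruct Ho' as [Ho' | e].
    + right. exists (v ▷ l'). now rewrite !app_assoc.
    + eapply bases_snoc; eauto. now split.
    + apply app_inj_tail in e as [-> ->]. elim Hnd. now exists X, v.
  - intros p q' Hq. right. exists q'. split; [constructor | easy].
  - intros p q r Hb IHb Hr IHr q' Hq.
    destruct Hq as [<- | Hq]; [right; exists r; split; [econstructor; eauto | now left]|].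
    destruct (IHb q') as [-> | (x' & Hx & Htw)]; [now right | |].
    + destruct Hq as (v & e & ->).
      rewrite <- (app_nil_r (merge_path X)) in e at 1.
      apply app_inv_head in e as <-. rewrite app_nil_r.
      apply bases_star_merged_twin. econstructor; eauto.
    + destruct (IHr _ Htw) as [Hl | (r' & Hr' & Htw')]; [now left | right].
      exists r'. split; [econstructor; eauto | easy].
  - intros s d k n w c Hc IH d0 k0 s' e Hd Hs. apply app_inj_tail in e as [-> ->].
    destruct (IH Hd) as (x & <- & Hx). destruct (Hx _ Hs) as (c' & Hc' & Htw).
    exists (c' ++ w). split; [now constructor | now apply twin_app].
  - intros S d c Hc _. exists c. split; [easy|]. intros c' Htw. exists c'.
    split; [now constructor | easy].
  - intros S d k n c t x Hc Hs IHs Ht IHt Hd. exists c. split; [easy|]. intros c' Hq.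
    (* The override component here is [d ▷ k], outside the wrappers by [Hd]; hence [d] is outside
       too and the climb can go on. *)
    destruct (IHs _ Hq Hd) as (t' & Hs' & Htw).
    destruct IHt as (y & <- & Hy).
    { intros Hin. now apply Hd, inside_wrapper_snoc. }
    destruct (Hy _ Htw) as (x' & Hx & Htw'). exists x'.
    split; [eapply this_succ; eauto | easy].
Qed.

Lemma outer_overrides_transfer w o :
  outer_overrides doc X w o -> outer_overrides doc Y w o.
Proof.
  intros [(t & Hs) Ho]. split; [|easy].
  destruct (supers_twin _ _ _ Hs (merge_path Y ++ w)) as (t' & Hs' & _).
  - right. eauto.
  - intros (k & v & ->). now apply Ho.
  - eauto.
Qed.

(** Existence rests on an override component [b] of the parent that defines the last label. Such a
    [b] lies outside the wrappers, so it transfers. *)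
Lemma path_exists_transfer w :
  path_exists doc (merge_path X ++ w) -> path_exists doc (merge_path Y ++ w).
Proof.
  destruct w as [| l w _] using rev_ind.
  - intros _. rewrite app_nil_r. apply (supers_exists_iff doc [merge_label]).
    exists [], [merge_label]. split; [apply supers_merge_self|].
    apply has_merge. cbn in HY |- *. tauto.
  - rewrite !app_assoc, !supers_exists_iff. intros (t & b & Hs & Hh).
    destruct (supers_twin _ _ _ Hs (merge_path Y ++ w)) as (t' & Hs' & _).
    + right. eauto.
    + now apply has_not_inside in Hh.
    + eauto.
Qed.

End Transfer.

End Merge.

Theorem theoremB3 (doc : node) (p1 p2 p3 : path)
  (Hwf : well_formed doc)
  (Hexists : forall p, In p [p1; p2; p3] -> path_exists doc p)
  (Htop : forall p, In p [p1; p2; p3] -> first_label_at_top doc p)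
  (Hmerge : member doc [] (merge_definition p1 p2 p3))
  (Hreserved : reserved doc merge_label (merge_definition p1 p2 p3))
  (Hwrappers : forall p l, In p [p1; p2; p3] -> hd_error p = Some l ->
     ~ In l wrapper_labels)
  (w : path) :
  (forall o, outer_overrides doc merged_left w o <->
             outer_overrides doc merged_right w o) /\
  (forall o, outer_overrides doc merged_right w o <->
             outer_overrides doc merged_flat w o) /\
  ((forall X, In X [merged_left; merged_right; merged_flat] ->
      path_exists doc ([merge_label; X] ++ w)) \/
   (forall X, In X [merged_left; merged_right; merged_flat] ->
      ~ path_exists doc ([merge_label; X] ++ w))).
Proof.
  split; [|split].
  1,2: intros o; split; apply (outer_overrides_transfer doc p1 p2 p3); cbn; auto.
  (* Existence for [merged_left] decides the other two, since existence transfers in both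
     directions. *)
  destruct (classic (path_exists doc ([merge_label; merged_left] ++ w))) as [H | H].
  - left. intros X HX. revert H.
    apply (path_exists_transfer doc p1 p2 p3); cbn; auto.
  - right. intros X HX HE. apply H. revert HE.
    apply (path_exists_transfer doc p1 p2 p3); cbn; auto.
Qed.
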